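(* Let $\mathcal{X}$ and $\mathcal{Y}$ be separable Hilbert spaces. Let $\phi_1,\dots,\phi_n\in\mathcal{X}$, and let $\{\tilde\psi_i\}_{i=1}^n$ be a set of points in $\mathcal{X}$ such that $\operatorname{span}(\{\tilde\psi_i\}_{i=1}^n)=\operatorname{span}(\{\phi_i\}_{i=1}^n)$. For each $i$ define $$\tilde\varphi_i=\big(\langle\phi_i,\tilde\psi_1\rangle,\dots,\langle\phi_i,\tilde\psi_n\rangle\big)^T\in\mathbb{R}^n .$$ For an objective function $f$ depending only on $\{\langle A\phi_i,A\phi_j\rangle\}_{i,j=1}^n$, the optimization $$\min_{A}\ f\big(\langle A\phi_1,A\phi_1\rangle,\dots,\langle A\phi_i,A\phi_j\rangle,\dots,\langle A\phi_n,A\phi_n\rangle\big)\quad\text{s.t. } A:\mathcal{X}\to\mathcal{Y}\text{ is a bounded linear map}$$ has the same optimal value as $$\min_{A'\in\mathbb{R}^{n\times n}}\ f\big(\tilde\varphi_1^T A'^T A'\tilde\varphi_1,\dots,\tilde\varphi_i^T A'^T A'\tilde\varphi_j,\dots,\tilde\varphi_n^T A'^T A'\tilde\varphi_n\big).$$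
   Context: Hilbert spaces are real. $\mathcal{X}$ is a feature space and $\phi_1,\dots,\phi_n$ are the images in it of $n$ training examples. The function $f$ is a real-valued function of the $n^2$ real arguments indexed by pairs $(i,j)$, $1\le i,j\le n$; it is an objective function that depends on the map $A$ only through the inner products $\langle A\phi_i,A\phi_j\rangle$.
   Formalization: The formal theorem additionally assumes that the dimension of span{φ_i} is at most the dimension of Y (automatic if Y is infinite-dimensional); without it the claim fails, e.g. Y = {0}, X = R, n = 1, φ_1 = ψ̃_1 = 1, f(t) = −t. *)

(* Defs.v *)
From HB Require Import structures.
From mathcomp Require Import all_boot all_order all_algebra.
From mathcomp Require Import all_classical all_reals all_analysis.

Set Implicit Arguments.
Unset Strict Implicit.
Unset Printing Implicit Defensive.

Import Order.TTheory GRing.Theory Num.Theory.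
Import numFieldNormedType.Exports.

Local Open Scope classical_set_scope.
Local Open Scope ring_scope.

(* A real Hilbert space is a Banach space whose norm comes from an inner
   product; {dot H for idfun} is the type of symmetric positive definite
   bilinear forms on H. *)
HB.mixin Record CompleteNormedModule_isHilbert (R : realType) H
    of CompleteNormedModule R H := {
  inner : {dot H for (@idfun R)} ;
  inner_sqr_norm : forall x : H, inner x x = `|x| ^+ 2
}.

#[short(type="hilbertType")]
HB.structure Definition Hilbert (R : realType) :=
  {H of CompleteNormedModule R H & CompleteNormedModule_isHilbert R H}.

Definition separable_space (T : topologicalType) : Prop :=
  exists2 D : set T, countable D & dense D.

Section LinearAlgebra.
Variables (R : realType) (V : lmodType R).

Definition lin_span (n : nat) (v : 'I_n -> V) : set V :=
  [set x | exists c : 'I_n -> R, x = \sum_(i < n) c i *: v i].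

Definition lin_indep (n : nat) (v : 'I_n -> V) : Prop :=
  forall c : 'I_n -> R, \sum_(i < n) c i *: v i = 0 -> forall i, c i = 0.

End LinearAlgebra.

(* dim (span v) <= dim W, where W may be infinite-dimensional: any number of
   independent vectors found in span v is also found in W.  Operators into W
   only produce Gram matrices of rank at most dim W, so this is what makes every
   Gram matrix of vectors in a linear image of span v reachable inside W. *)
Definition dim_span_le (R : realType) (V W : lmodType R) (n : nat)
    (v : 'I_n -> V) : Prop :=
  forall (m : nat) (u : 'I_m -> V),
    (forall i, lin_span v (u i)) -> lin_indep u ->
    exists w : 'I_m -> W, lin_indep w.

Section Programs.
Variables (R : realType) (X Y : hilbertType R) (n : nat).
Variables (f : 'M[R]_n -> R) (phi psi : 'I_n -> X).

(* bounded_near A (nbhs 0) is boundedness of the operator A: it amounts to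
   `|A x| <= M * `|x| for some M and all x (see linear_boundedP). *)
Definition operator_values : set R :=
  [set f (\matrix_(i, j) inner (A (phi i)) (A (phi j))) |
    A in [set A : {linear X -> Y} | bounded_near A (nbhs (0 : X))]].

Definition feature_coord (i : 'I_n) : 'cV[R]_n :=
  \col_(k < n) inner (phi i) (psi k).

Definition matrix_values : set R :=
  [set f (\matrix_(i, j)
      ((feature_coord i)^T *m A'^T *m A' *m feature_coord j) 0 0) |
    A' in [set: 'M[R]_n]].

End Programs.

(* The value, in the extended reals, of the program that minimizes over the set
   S of objective values; it is -oo when S is unbounded below. *)
Definition optimal_value (R : realType) (S : set R) : \bar R :=
  ereal_inf (EFin @` S).

Definition is_minimum (R : realType) (S : set R) (v : R) : Prop :=
  S v /\ lbound S v.

(* Main.v *)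
(* Both programs range over the same set of Gram matrices.  Given A, expand the
   A phi_i in an orthonormal basis g_1, ..., g_m of their span (m <= n): each
   functional <A x, g_p>, restricted to span psi, is a combination of the
   <x, psi_k>, and the coefficients form an m x n matrix, which zero rows make
   square.  Given A', take an orthonormal basis h_1, ..., h_m of the span of the
   A' phi~_i in R^n.  Each h_p is the image of some u_p in span phi, and the u_p
   are independent, so the dimension hypothesis yields orthonormal g_1, ..., g_m
   in Y; the finite rank operator x |-> sum_p <x, a_p> g_p, where
   a_p = sum_l (A'^T h_p)_l psi_l, then has the same Gram matrix. *)
Require Import Defs.
From HB Require Import structures.
From mathcomp Require Import all_boot all_order all_algebra.
From mathcomp Require Import all_classical all_reals all_analysis.
From mathcomp Require Import lra.

Set Implicit Arguments.
Unset Strict Implicit.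
Unset Printing Implicit Defensive.

Import Order.TTheory GRing.Theory Num.Theory.
Import numFieldNormedType.Exports.

Local Open Scope classical_set_scope.
Local Open Scope ring_scope.

(** * Linear spans of finite families *)

Section LinSpan.
Variables (R : realType) (V : lmodType R).

Lemma lin_span_gen n (v : 'I_n -> V) i : lin_span v (v i).
Proof.
exists (fun j => (j == i)%:R).
rewrite (bigD1 i) //= eqxx scale1r big1 ?addr0// => j /negPf ->.
by rewrite scale0r.
Qed.

Lemma lin_span_comb n (v : 'I_n -> V) m (e : 'I_m -> V) (c : 'I_m -> R) :
  (forall k, lin_span v (e k)) -> lin_span v (\sum_k c k *: e k).
Proof.
move=> /choice[d ed]; exists (fun i => \sum_k c k * d k i).
under eq_bigr do rewrite ed scaler_sumr.
rewrite exchange_big /=; apply: eq_bigr => i _; rewrite scaler_suml.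
by apply: eq_bigr => k _; rewrite scalerA.
Qed.

Lemma lin_spanD n (v : 'I_n -> V) x y :
  lin_span v x -> lin_span v y -> lin_span v (x + y).
Proof.
move=> [c ->] [d ->]; exists (fun i => c i + d i).
by rewrite -big_split /=; apply: eq_bigr => i _; rewrite scalerDl.
Qed.

Lemma lin_spanZ n (v : 'I_n -> V) a x : lin_span v x -> lin_span v (a *: x).
Proof.
move=> [c ->]; exists (fun i => a * c i).
by rewrite scaler_sumr; apply: eq_bigr => i _; rewrite scalerA.
Qed.

Lemma lin_span_subset n (v : 'I_n -> V) m (w : 'I_m -> V) :
  (forall i, lin_span v (w i)) -> lin_span w `<=` lin_span v.
Proof. by move=> vw _ [c ->]; exact: lin_span_comb. Qed.

End LinSpan.

(** * Gram-Schmidt and its consequences for a dot product [b] *)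

Section Orthonormal.
Variables (R : realType) (V : lmodType R) (b : {dot V for (@idfun R)}).

Definition orthonormal_family m (e : 'I_m -> V) : Prop :=
  forall i j, b (e i) (e j) = (i == j)%:R.

Lemma dotC u v : b u v = b v u.
Proof. by rewrite hermC /= expr0 mul1r. Qed.

Lemma dotDl u v w : b (u + v) w = b u w + b v w.
Proof. exact: linearDl. Qed.

Lemma dotZl a u w : b (a *: u) w = a * b u w.
Proof. exact: linearZl_LR. Qed.

Lemma dotDr u v w : b u (v + w) = b u v + b u w.
Proof. exact: linearDr. Qed.

Lemma dotZr a u w : b u (a *: w) = a * b u w.
Proof. exact: linearZr_LR. Qed.

Lemma dot_suml m (c : 'I_m -> R) (e : 'I_m -> V) u :
  b (\sum_k c k *: e k) u = \sum_k c k * b (e k) u.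
Proof.
by rewrite [LHS]linear_sumlz; apply: eq_bigr => k _; exact: dotZl.
Qed.

Lemma dot_sumr m (c : 'I_m -> R) (e : 'I_m -> V) u :
  b u (\sum_k c k *: e k) = \sum_k c k * b u (e k).
Proof. by rewrite dotC dot_suml; apply: eq_bigr => k _; rewrite dotC. Qed.

Lemma dot_orthonormal_comb m (e : 'I_m -> V) (c : 'I_m -> R) k :
  orthonormal_family e -> b (\sum_l c l *: e l) (e k) = c k.
Proof.
move=> oe; rewrite dot_suml (bigD1 k) //= oe eqxx mulr1.
by rewrite big1 ?addr0// => l /negPf lk; rewrite oe lk mulr0.
Qed.

(** Only [x] is expanded, so [y] may lie outside the span of [e]. *)
Lemma parseval m (e : 'I_m -> V) x y :
  x = \sum_k b x (e k) *: e k -> b x y = \sum_k b x (e k) * b y (e k).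
Proof.
move=> {1}->; rewrite dot_suml.
by apply: eq_bigr => k _; rewrite (dotC y).
Qed.

(** Induction: orthonormalize the tail of [v], then take the residue [r] of [v ord0] modulo its
    projection [p]. A zero residue adds no vector, so dependent families are allowed and [m] may be
    smaller than [n]. *)
Lemma gram_schmidt n (v : 'I_n -> V) :
  exists m (e : 'I_m -> V), [/\ (m <= n)%N, orthonormal_family e,
    forall k, lin_span v (e k) &
    forall x, lin_span v x -> x = \sum_k b x (e k) *: e k].
Proof.
elim: n v => [|n IHn] v.
  exists 0%N, v; split=> //; try by case.
  by move=> x [c ->]; rewrite !big_ord0.
have [m [e [mn oe ve ev]]] := IHn (v \o lift ord0).
have vle k : lin_span v (e k).
  by apply: (lin_span_subset _ (ve k)) => i; exact: lin_span_gen.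
pose p := \sum_k b (v ord0) (e k) *: e k.
pose r := v ord0 - p.
have re k : b r (e k) = 0.
  rewrite dotDl -scaleN1r dotZl mulN1r.
  by rewrite (dot_orthonormal_comb (fun l => b (v ord0) (e l)))// subrr.
have v0E : v ord0 = r + p by rewrite subrK.
(* The part [y] collects the multiple of [p] and the tail terms, all of which the [e k] already
   expand. *)
have spanE x : lin_span v x -> exists a y, x = a *: r + y /\
    y = \sum_k b y (e k) *: e k.
  move=> [c ->]; rewrite big_ord_recl v0E; exists (c ord0).
  exists (c ord0 *: p + \sum_i c (lift ord0 i) *: v (lift ord0 i)).
  split; first by rewrite scalerDr addrA.
  have pE : p = \sum_k b p (e k) *: e k.
    apply: eq_bigr => k _.
    by rewrite (dot_orthonormal_comb (fun l => b (v ord0) (e l))).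
  rewrite {1}pE {1}[\sum_i c _ *: _]ev; last by exists (c \o lift ord0).
  rewrite scaler_sumr -big_split /=; apply: eq_bigr => k _.
  by rewrite dotDl dotZl scalerDl scalerA.
have [r0|rn0] := eqVneq r 0.
  exists m, e; split=> //; first exact: leqW.
  by move=> x /spanE[a [y [-> yE]]]; rewrite r0 scaler0 add0r.
pose s := Num.sqrt (b r r).
have rr0 : 0 < b r r by exact: neq0_dnorm_gt0.
have s0 : s != 0 by rewrite gt_eqF// sqrtr_gt0.
have ssE : s * s = b r r by rewrite -expr2 sqr_sqrtr// ltW.
pose e' (k : 'I_m.+1) := oapp e (s^-1 *: r) (unlift ord0 k).
have e'0 : e' ord0 = s^-1 *: r by rewrite /e' unlift_none.
have e'S k : e' (lift ord0 k) = e k by rewrite /e' liftK.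
exists m.+1, e'; split=> //.
- have oe'0 k : b (e' ord0) (e' (lift ord0 k)) = 0.
    by rewrite e'0 e'S dotZl re mulr0.
  move=> i j; case: (unliftP ord0 i) => [i'|] ->;
    case: (unliftP ord0 j) => [j'|] ->.
  + by rewrite !e'S oe (inj_eq lift_inj).
  + by rewrite dotC oe'0 eq_sym (negPf (neq_lift _ _)).
  + by rewrite oe'0 (negPf (neq_lift _ _)).
  + by rewrite e'0 dotZl dotC dotZl -ssE mulKf// mulVf// eqxx.
- move=> k; case: (unliftP ord0 k) => [k'|] ->; first by rewrite e'S.
  rewrite e'0; apply/lin_spanZ/lin_spanD; first exact: lin_span_gen.
  by rewrite -scaleN1r; apply/lin_spanZ/lin_span_comb.
(* As [y] is orthogonal to [r], the coefficient of [x] along [e' ord0] is [a * s], which restores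
   [a *: r]. *)
- move=> x /spanE[a [y [-> yE]]].
  rewrite big_ord_recl e'0; congr (_ + _).
    rewrite scalerA dotC dotDr dotZr dotZl -ssE.
    have -> : b (s^-1 *: r) y = 0.
      rewrite yE dot_sumr big1// => k _.
      by rewrite dotZl re !mulr0.
    by rewrite addr0 mulKf// mulfK.
  rewrite {1}yE; apply: eq_bigr => k _.
  by rewrite e'S dotDl dotZl re mulr0 add0r.
Qed.

(** Gram-Schmidt gives [q <= m] vectors. Independence of [w] makes the rows of its coordinate matrix
    [C] free, so [m <= q] as well. *)
Lemma orthonormal_of_lin_indep m (w : 'I_m -> V) :
  lin_indep w -> exists e : 'I_m -> V, orthonormal_family e.
Proof.
move=> wi; have [q [e [qm oe we ew]]] := gram_schmidt w.
pose C := \matrix_(i < m, k < q) b (w i) (e k).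
have /eqP Cfree : \rank C == m.
  apply: inj_row_free => u uC0; apply/rowP => i; rewrite mxE.
  apply: (wi (u 0)).
  transitivity (\sum_k (u *m C) 0 k *: e k).
    under eq_bigr do rewrite (ew _ (lin_span_gen w _)) scaler_sumr.
    rewrite exchange_big /=; apply: eq_bigr => k _.
    rewrite mxE scaler_suml; apply: eq_bigr => j _.
    by rewrite scalerA mxE.
  by rewrite uC0 big1// => k _; rewrite mxE scale0r.
have mq : (m <= q)%N by rewrite -Cfree rank_leq_col.
have qmE : q = m by apply/eqP; rewrite eqn_leq qm mq.
by subst q; exists e.
Qed.

(** Finite-dimensional Riesz representation: on the span, [L] is the pairing with
    [\sum_l L (e l) *: e l], and each [e l] is then rewritten in terms of [v]. *)
Lemma functional_on_lin_span n (v : 'I_n -> V) (L : {linear V -> R^o}) :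
  exists c : 'I_n -> R,
    forall x, lin_span v x -> L x = \sum_k c k * b x (v k).
Proof.
have [m [e [_ _ /choice[d ed] ev]]] := gram_schmidt v.
exists (fun k => \sum_l L (e l) * d l k) => x xv.
rewrite {1}(ev x xv) linear_sum /=.
under [RHS]eq_bigr do rewrite mulr_suml.
rewrite exchange_big /=; apply: eq_bigr => l _.
rewrite linearZ /= [_ *: _]mulrC [in b x _]ed dot_sumr mulr_sumr.
by apply: eq_bigr => k _; rewrite mulrA.
Qed.

End Orthonormal.

(** * The standard dot product on column vectors, packaged so that Gram-Schmidt applies to it *)

Section ColumnDot.
Variables (R : realType) (n : nat).

Definition coldot (u v : 'cV[R]_n) : R := (u^T *m v) 0 0.

Lemma coldotE u v : coldot u v = \sum_k u k 0 * v k 0.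
Proof. by rewrite /coldot mxE; apply: eq_bigr => k _; rewrite mxE. Qed.

Lemma coldot_linearl v : linear_for *%R (coldot^~ v).
Proof. by move=> a x y; rewrite /coldot linearP mulmxDl -scalemxAl !mxE. Qed.

Lemma coldot_linearr u : linear_for (idfun \; *%R) (coldot u).
Proof. by move=> a x y; rewrite /coldot mulmxDr -scalemxAr !mxE. Qed.

HB.instance Definition _ := bilinear_isBilinear.Build R 'cV[R]_n 'cV[R]_n R
  *%R (idfun \; *%R) coldot (coldot_linearl, coldot_linearr).

Lemma coldotC u v : coldot u v = (-1) ^+ false * idfun (coldot v u).
Proof.
rewrite expr0 mul1r !coldotE /=.
by apply: eq_bigr => k _; rewrite mulrC.
Qed.

HB.instance Definition _ :=
  isHermitianSesquilinear.Build R 'cV[R]_n false idfun coldot coldotC.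

Lemma coldot_gt0 u : u != 0 -> 0 < coldot u u.
Proof.
move=> un0; rewrite lt_neqAle coldotE sumr_ge0 ?andbT; last first.
  by move=> k _; rewrite -expr2 sqr_ge0.
apply: contra un0 => /eqP/esym u0; apply/eqP/colP => k; rewrite mxE.
have sq_ge0 i : true -> 0 <= u i 0 * u i 0 by rewrite -expr2 sqr_ge0.
have /eqP := @psumr_eq0P _ _ _ _ sq_ge0 u0 k isT.
by rewrite mulf_eq0 orbb => /eqP.
Qed.

HB.instance Definition _ :=
  isDotProduct.Build R 'cV[R]_n coldot coldot_gt0.

End ColumnDot.

Lemma coldot_mulmx (R : realType) m n (A B : 'M[R]_(m, n)) (u v : 'cV[R]_n) :
  ((u^T *m A^T) *m B *m v) 0 0 = coldot (A *m u) (B *m v).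
Proof. by rewrite /coldot trmx_mul !mulmxA. Qed.

Lemma square_of_rect (R : realType) q n (M : 'M[R]_(q, n)) :
  (q <= n)%N -> exists A : 'M[R]_n, A^T *m A = M^T *m M.
Proof.
(* This [pid_mx q] is n x q: it appends zero rows to [M], and its columns are orthonormal because
   [q <= n]. *)
move=> qn; exists (pid_mx q *m M).
rewrite trmx_mul tr_pid_mx !mulmxA -[_ *m pid_mx q *m pid_mx q]mulmxA.
by rewrite mul_pid_mx minnn (minn_idPr qn) pid_mx_1 mulmx1.
Qed.

(** * Cauchy-Schwarz and bounded operators of finite rank *)

Section FiniteRank.
Variables (R : realType) (X Y : hilbertType R).

(** Expanding both sides of the squared triangle inequality leaves exactly this bound, doubled. *)
Lemma inner_norm_le (x y : X) : inner x y <= `|x| * `|y|.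
Proof.
have : `|x + y| ^+ 2 <= (`|x| + `|y|) ^+ 2.
  by rewrite ler_pXn2r// ?nnegrE// ?addr_ge0// ler_normD.
rewrite -inner_sqr_norm dotDl !dotDr (dotC _ y x) !inner_sqr_norm.
by move=> h; lra.
Qed.

Lemma cauchy_schwarz (x y : X) : `|inner x y| <= `|x| * `|y|.
Proof.
rewrite ler_norml inner_norm_le andbT lerNl.
by rewrite -mulN1r -dotZl scaleN1r (le_trans (inner_norm_le _ _))// normrN.
Qed.

Variables (m : nat) (a : 'I_m -> X) (g : 'I_m -> Y).

Definition finite_rank (x : X) : Y := \sum_p inner x (a p) *: g p.

Lemma finite_rank_linear : linear finite_rank.
Proof.
move=> c x y; rewrite /finite_rank scaler_sumr -big_split /=.
by apply: eq_bigr => p _; rewrite dotDl dotZl scalerDl scalerA.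
Qed.

HB.instance Definition _ := GRing.isLinear.Build R X Y *:%R finite_rank
  finite_rank_linear.

Lemma finite_rank_bounded : bounded_near finite_rank (nbhs (0 : X)).
Proof.
apply/linear_boundedP; near=> r => x.
rewrite (@le_trans _ _ ((\sum_p `|a p| * `|g p|) * `|x|))//; last first.
  by rewrite ler_wpM2r//; near: r; exact: nbhs_pinfty_ge.
rewrite (le_trans (ler_norm_sum _ _ _))// mulr_suml ler_sum// => p _.
by rewrite normrZ mulrAC ler_wpM2r// mulrC cauchy_schwarz.
Unshelve. all: by end_near. Qed.

End FiniteRank.

(** * The two inclusions between the sets of objective values *)

Section Programs.
Variables (R : realType) (X Y : hilbertType R) (n : nat).
Variables (f : 'M[R]_n -> R) (phi psi : 'I_n -> X).

Lemma feature_coord_mulmx m (M : 'M[R]_(m, n)) i p :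
  (M *m feature_coord phi psi i) p 0 = inner (phi i) (\sum_k M p k *: psi k).
Proof.
by rewrite dot_sumr mxE; apply: eq_bigr => k _; rewrite mxE.
Qed.

Lemma operator_values_sub : (forall i, lin_span psi (phi i)) ->
  operator_values Y f phi `<=` matrix_values f phi psi.
Proof.
move=> psiphi _ [A _ <-].
have [m [g [mn _ _ eg]]] := gram_schmidt inner (A \o phi).
have /choice[c cE] p : exists c : 'I_n -> R, forall x, lin_span psi x ->
    inner (A x) (g p) = \sum_k c k * inner x (psi k).
  pose L x : R^o := inner (g p) (A x).
  have Llin : linear L.
    by move=> t x y; rewrite /L linearP dotDr dotZr.
  pose LL : {linear X -> R^o} :=
    HB.pack L (GRing.isLinear.Build _ _ _ _ L Llin).
  have [c cE] := functional_on_lin_span inner psi LL.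
  by exists c => x /cE <-; rewrite dotC.
have [A' A'E] := square_of_rect (\matrix_(p, k) c p k) mn.
exists A' => //; congr f; apply/matrixP => i j; rewrite [LHS]mxE [RHS]mxE.
(* Only the product [A'^T *m A'] matters, so the square [A'] gives way to the m x n coefficient
   matrix. *)
rewrite -[_ *m A'^T *m A']mulmxA A'E mulmxA coldot_mulmx coldotE.
rewrite (parseval _ (eg _ (lin_span_gen (A \o phi) i))).
apply: eq_bigr => p _; rewrite !feature_coord_mulmx !cE// !dot_sumr.
by congr (_ * _); apply: eq_bigr => k _; rewrite mxE.
Qed.

Lemma matrix_values_sub : dim_span_le Y phi ->
  matrix_values f phi psi `<=` operator_values Y f phi.
Proof.
move=> dimY _ [A' _ <-].
pose F i := A' *m feature_coord phi psi i.
have [m [h [_ oh Fh eh]]] := gram_schmidt (@coldot R n) F.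
have /choice[d dE] := Fh.
pose u p := \sum_i d p i *: phi i.
(* The linear map sending [x] to [A'] times the column of the [inner x (psi l)] takes [u p] to
   [h p]; a relation among the [u p] thus passes to the orthonormal [h p]. *)
have ui : lin_indep u.
  move=> c cu0 q.
  rewrite -(dot_orthonormal_comb c q oh).
  suff -> : \sum_p c p *: h p = 0 by rewrite linear0l.
  apply/colP => k; rewrite [RHS]mxE.
  (* The [k]-th coordinate of that map is the pairing with this combination of the [psi l]. *)
  transitivity (inner (\sum_p c p *: u p) (\sum_l A' k l *: psi l)); last first.
    by rewrite cu0 linear0l.
  rewrite dot_suml summxE; apply: eq_bigr => p _.
  rewrite dot_suml mxE dE summxE; congr (_ * _); apply: eq_bigr => i _.
  by rewrite mxE feature_coord_mulmx.
have [w wi] := dimY m u (fun p => ex_intro _ (d p) erefl) ui.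
have [g og] := orthonormal_of_lin_indep inner wi.
pose a p := \sum_l (A'^T *m h p) l 0 *: psi l.
(* Here [a p] is the image of [h p] under the adjoint of that map. *)
have aE i p : inner (phi i) (a p) = coldot (F i) (h p).
  rewrite dot_sumr /F /coldot trmx_mul -mulmxA -/(coldot _ _) coldotE.
  by apply: eq_bigr => l _; rewrite mulrC [in RHS]mxE.
exists (finite_rank a g); first exact: finite_rank_bounded.
congr f; apply/matrixP => i j; rewrite [LHS]mxE [RHS]mxE.
rewrite coldot_mulmx.
have gE x p : inner (finite_rank a g x) (g p) = inner x (a p).
  exact: (dot_orthonormal_comb (fun q => inner x (a q))).
(* The image of [phi i] has the same coordinates along [g] as [F i] has along [h], so Parseval on
   both sides equates the Gram entries. *)
rewrite (parseval (e := g)); last by apply: eq_bigr => p _; rewrite gE.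
rewrite [RHS](parseval _ (eh _ (lin_span_gen F i))).
by apply: eq_bigr => p _; rewrite !gE !aE.
Qed.

End Programs.

Theorem theorem1 (R : realType) (X Y : hilbertType R)
    (sepX : separable_space X) (sepY : separable_space Y)
    (n : nat) (phi psi : 'I_n -> X)
    (span_eq : lin_span psi = lin_span phi)
    (dimY : dim_span_le Y phi)
    (f : 'M[R]_n -> R) :
  optimal_value (operator_values Y f phi) =
    optimal_value (matrix_values f phi psi)
  /\ (forall v : R, is_minimum (operator_values Y f phi) v <->
                    is_minimum (matrix_values f phi psi) v).
Proof.
(* Infimum and attained minimum depend only on the set of values. *)
suff -> : operator_values Y f phi = matrix_values f phi psi by [].
apply/seteqP; split; last exact: matrix_values_sub.
by apply: operator_values_sub => i; rewrite span_eq; exact: lin_span_gen.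
Qed.
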